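(* Let $R$ be an integrally closed integral domain with fraction field $K$ and fixed separable closure $\bar K$. Let $N\ge1$ and $f=\sum_{\mathbf m\in\mathbb{Z}^N} a_{\mathbf m}(f)\mathbf X^{\mathbf m}\in R[X_1^{\pm1},\ldots,X_N^{\pm1}]$ be non-zero, with $M(f)=\{\mathbf m: a_{\mathbf m}(f)\ne0\}$. For a torsion point $\boldsymbol\xi\in(\bar K^* )^N$ define \[ C_f(\boldsymbol\xi)=\prod_{\tau\in\mathrm{Gal}(K(\boldsymbol\xi^{M(f)})/K)}\tau\bigl(f(\boldsymbol\xi)\bigr). \] (a) $C_f(\boldsymbol\xi)\in R$. (b) Let $\Lambda\subseteq(\bar K^* )^N$ be a finite cyclic group and let $\boldsymbol\xi_1,\ldots,\boldsymbol\xi_r$ be generators of $\Lambda$ that are representatives of the distinct orbits of $\mathrm{Gal}(\bar K/K)$ acting on the set of generators of $\Lambda$. Then in $R$, \[ V_f(\Lambda)=\prod_{\substack{1\le i\le r\\ f(\boldsymbol\xi_i)\ne0}} C_f(\boldsymbol\xi_i)^{[K(\boldsymbol\xi_i):K(\boldsymbol\xi_i^{M(f)})]}. \] (c) For every finite subgroup $\Lambda\subseteq(\bar K^* )^N$, in $R$, \[ W_f(\Lambda)=\prod_{\substack{\text{cyclic subgroups}\\ \Lambda'\subseteq\Lambda}}\ \prod_{\substack{\boldsymbol\xi:\ \text{generators of }\Lambda'\text{ in distinct}\\ \mathrm{Gal}(\bar K/K)\text{-orbits},\ f(\boldsymbol\xi)\ne0}} C_f(\boldsymbol\xi)^{[K(\boldsymbol\xi):K(\boldsymbol\xi^{M(f)})]},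 \] where for each $\Lambda'$ one representative generator is taken from each Galois orbit of generators.
   Context: $\mathbf X^{\mathbf m}=X_1^{m_1}\cdots X_N^{m_N}$. For a finite set $M\subset\mathbb{Z}^N$, $\boldsymbol\xi^M=\{\boldsymbol\xi^{\mathbf m}:\mathbf m\in M\}$ with $\boldsymbol\xi^{\mathbf m}=\xi_1^{m_1}\cdots\xi_N^{m_N}$, and $K(\boldsymbol\xi^M)$ is the field generated over $K$ by these elements (an abelian Galois extension of $K$). For a finite subgroup $\Lambda$, $W_f(\Lambda)=\prod_{\boldsymbol\zeta\in\Lambda,\,f(\boldsymbol\zeta)\ne0}f(\boldsymbol\zeta)$ and $V_f(\Lambda)=\prod_{\boldsymbol\zeta:\langle\boldsymbol\zeta\rangle=\Lambda,\ f(\boldsymbol\zeta)\ne0}f(\boldsymbol\zeta)$, where $\langle\boldsymbol\zeta\rangle$ is the cyclic subgroup generated by $\boldsymbol\zeta$. Empty products are $1$. *)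

(* Defs.v *)
From HB Require Import structures.
From mathcomp Require Import all_boot all_order all_algebra all_field.
From mathcomp Require Import finmap.
From mathcomp Require Import boolp classical_sets fsbigop.
From mathcomp Require Import multinomials.monalg.

Set Implicit Arguments.
Unset Strict Implicit.
Unset Printing Implicit Defensive.

Import GRing.Theory.
Local Open Scope ring_scope.

Definition integrally_closed (R : idomainType) : Prop :=
  forall x : {fraction R}, integralOver (@tofrac R) x ->
    exists r : R, x = tofrac r.

(* An irreducible polynomial over K with root x is the minimal polynomial of x
   up to a nonzero scalar. *)
Definition separable_element (K L : fieldType) (iota : {rmorphism K -> L})
    (x : L) : Prop :=
  exists p : {poly K},
    [/\ irreducible_poly p, separable_poly p & root (map_poly iota p) x].

Definition separable_closure (K L : fieldType) (iota : {rmorphism K -> L}) :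
    Prop :=
  (forall x : L, separable_element iota x) /\
  (forall p : {poly L}, (1 < size p)%N -> separable_poly p ->
     exists x, root p x).

(* The underlying maps of the automorphisms of E over K. *)
Definition Gal (K E : fieldType) (j : {rmorphism K -> E}) : set (E -> E) :=
  [set tau : E -> E |
     [/\ exists s : {rmorphism E -> E}, tau = s :> (E -> E),
         bijective tau
       & forall a, tau (j a) = j a]].

Section Adjoin.

Variables (K L : fieldType) (iota : {rmorphism K -> L}) (S : set L).

(* The subfield K(S) of L. *)
Definition adjoin : {pred L} := fun x =>
  `[< forall F : {pred L}, GRing.divring_closed F ->
        (forall a, iota a \in F) -> (forall s, S s -> s \in F) -> x \in F >].

Fact adjoin_divring_closed : GRing.divring_closed adjoin.
Proof.
split.
- by apply/asboolP => F [].
- move=> x y /asboolP xK /asboolP yK; apply/asboolP => F clF KF SF.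
  by case: (clF) => _ clB _; apply: clB; [apply: xK | apply: yK].
- move=> x y /asboolP xK /asboolP yK; apply/asboolP => F clF KF SF.
  by case: (clF) => _ _ clD; apply: clD; [apply: xK | apply: yK].
Qed.

HB.instance Definition _ :=
  GRing.isDivringClosed.Build L adjoin adjoin_divring_closed.

Fact base_adjoin a : iota a \in adjoin.
Proof. by apply/asboolP => F _ KF _; apply: KF. Qed.

Fact mem_adjoin s : S s -> s \in adjoin.
Proof. by move=> Ss; apply/asboolP => F _ _; apply. Qed.

Record adjoin_field :=
  AdjoinField { adjoin_val : L; adjoin_valP : adjoin_val \in adjoin }.

HB.instance Definition _ := [isSub for adjoin_val].
HB.instance Definition _ := [Choice of adjoin_field by <:].
HB.instance Definition _ :=
  [SubChoice_isSubComUnitRing of adjoin_field by <:].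
HB.instance Definition _ :=
  [SubComUnitRing_isSubIntegralDomain of adjoin_field by <:].
HB.instance Definition _ :=
  [SubIntegralDomain_isSubField of adjoin_field by <:].

Definition to_adjoin (a : K) : adjoin_field := AdjoinField (base_adjoin a).

Fact to_adjoin_is_zmod_morphism : zmod_morphism to_adjoin.
Proof. by move=> a b; apply: val_inj; rewrite /= rmorphB. Qed.

Fact to_adjoin_is_monoid_morphism : monoid_morphism to_adjoin.
Proof.
by split=> [|a b]; apply: val_inj; rewrite /= ?rmorph1 ?rmorphM.
Qed.

HB.instance Definition _ :=
  GRing.isZmodMorphism.Build K adjoin_field to_adjoin
    to_adjoin_is_zmod_morphism.
HB.instance Definition _ :=
  GRing.isMonoidMorphism.Build K adjoin_field to_adjoin
    to_adjoin_is_monoid_morphism.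

End Adjoin.

Section Degree.

Variables (L : fieldType) (E F : {pred L}).

Definition is_basis (n : nat) (b : 'I_n -> L) : Prop :=
  [/\ forall i, b i \in F,
      forall c : 'I_n -> L, (forall i, c i \in E) ->
        \sum_i c i * b i = 0 -> forall i, c i = 0
    & forall x, x \in F -> exists2 c : 'I_n -> L,
        (forall i, c i \in E) & x = \sum_i c i * b i].

(* The degree [F : E] for subfields E <= F of L, with value 0 when it is
   infinite. *)
Definition ext_degree : nat :=
  xget 0%N [set n : nat | exists b : 'I_n -> L, is_basis b].

End Degree.

(* {malg R[Z^N]} is the free R-module on Z^N: f@_m is the coefficient a_m(f)
   and msupp f is M(f). *)
Notation laurent R N := {malg R[{ffun 'I_N -> int}]}.

Section Torus.

Variables (L : fieldType) (N : nat).

(* Points of the torus (L^* )^N are elements of L^N with nonzero coordinates;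
   products of points are taken in the ring L^N. *)
Local Notation pt := {ffun 'I_N -> L}.
Implicit Types (x z : pt) (m : {ffun 'I_N -> int}) (H : {fset pt}).

Definition monomial x m : L := \prod_(i < N) x i ^ m i.

Definition torsion_point x : Prop := exists2 n : nat, (0 < n)%N & x ^+ n = 1.

Definition finite_subgroup H : Prop :=
  [/\ forall x, x \in H -> forall i, x i != 0,
      1 \in H,
      forall x z, x \in H -> z \in H -> x * z \in H
    & forall x, x \in H -> [ffun i => (x i)^-1] \in H].

Definition generates z H : Prop :=
  forall x, x \in H <-> exists k : int, x = [ffun i => z i ^ k].

Definition finite_cyclic_subgroup H : Prop :=
  finite_subgroup H /\ exists z, generates z H.

End Torus.

Section LaurentTorsion.

Variables (R : idomainType) (L : fieldType) (N : nat).
Variable iota : {rmorphism {fraction R} -> L}.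

Local Notation pt := {ffun 'I_N -> L}.
Implicit Types (f : laurent R N) (x y z : pt) (H : {fset pt}).

Definition in_base (a : L) : Prop := exists r : R, a = iota (tofrac r).

Definition leval f x : L :=
  \sum_(m <- msupp f) iota (tofrac f@_m) * monomial x m.

(* The set x^M for M = M(f). *)
Definition support_values f x : set L :=
  [set a | exists2 m, m \in msupp f & a = monomial x m].

Definition coordinates x : set L := [set a | exists i, a = x i].

Fact leval_adjoin f x : leval f x \in adjoin iota (support_values f x).
Proof.
rewrite /leval big_seq; apply: rpred_sum => m fm.
by apply: rpredM; [apply: base_adjoin | apply: mem_adjoin; exists m].
Qed.

Definition Cf f x : L :=
  \big[*%R/1]_(tau \in Gal (to_adjoin iota (support_values f x)))
    val (tau (AdjoinField (leval_adjoin f x))).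

(* [K(x) : K(x^M(f))] *)
Definition Cexp f x : nat :=
  ext_degree (adjoin iota (support_values f x)) (adjoin iota (coordinates x)).

Definition Wf f H : L := \prod_(z <- H | leval f z != 0) leval f z.

Definition Vf f H : L :=
  \prod_(z <- H | `[< generates z H >] && (leval f z != 0)) leval f z.

Definition conjugate_points x y : Prop :=
  exists2 sigma, Gal iota sigma & y = [ffun i => sigma (x i)].

(* xi_0, ..., xi_(r-1) represent the distinct Galois orbits of generators. *)
Definition orbit_representatives H (r : nat) (xi : 'I_r -> pt) : Prop :=
  [/\ forall i, generates (xi i) H,
      forall i j, conjugate_points (xi i) (xi j) -> i = j
    & forall z, generates z H -> exists i, conjugate_points (xi i) z].

End LaurentTorsion.

(* Main.v *)
(** Partial [K]-homomorphisms of [L] are represented by their graphs, which are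
    subrings of [L * L]; by Zorn's lemma each extends to an automorphism of [L].
    The coordinates of a torsion point [x] generate a finite multiplicative
    group, hence [K(x) = K(w)] for a root of unity [w].  Every [tau] in
    [Gal(K(x^M)/K)] extends to [L], and the conjugates of [x] obtained from the
    extensions of [tau] correspond to the roots of the image under [tau] of the
    minimal polynomial of [w] over [K(x^M)]; there are [K(x) : K(x^M)] of them,
    and [f] takes the value [tau (f x)] at each.  Hence the product of [f] over
    the Galois orbit of [x] is [C_f(x)^[K(x) : K(x^M)]], and (b) and (c) follow
    by grouping the points by orbit and by generated subgroup.  For (a),
    [C_f(x)] is integral over [R] and fixed by all automorphisms, so it lies in
    [K], hence in [R]. *)

Require Import Defs.
From HB Require Import structures.
From mathcomp Require Import all_boot all_order all_algebra all_field.
From mathcomp Require Import cyclic finmap.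
From mathcomp Require Import boolp classical_sets fsbigop.
From mathcomp Require Import multinomials.monalg.

Set Implicit Arguments.
Unset Strict Implicit.
Unset Printing Implicit Defensive.

Import GRing.Theory.
Local Open Scope ring_scope.

(** Elements of [Gal] are bare maps, and homomorphisms are built below by choice; this supplies the
    bundled structure. *)
Lemma rmorphism_of (A B : nzRingType) (f : A -> B) :
    zmod_morphism f -> monoid_morphism f ->
  exists s : {rmorphism A -> B}, s = f :> (A -> B).
Proof.
move=> fB fM.
pose g := HB.pack_for {rmorphism A -> B} f
  (GRing.isZmodMorphism.Build A B f fB) (GRing.isMonoidMorphism.Build A B f fM).
by exists g.
Qed.

(** * Minimal polynomials over an embedded field *)

Section MinimalPolynomial.

Variables (F L : fieldType) (j : {rmorphism F -> L}).

Definition minimal_poly (w : L) (p : {poly F}) : Prop :=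
  [/\ p != 0, root (map_poly j p) w
    & forall q, root (map_poly j q) w -> p %| q].

(** Take a nonzero polynomial of least size vanishing at [w]. The remainder of any other such
    polynomial also vanishes at [w] and is smaller, so it is zero. *)
Lemma minimal_poly_exists w : algebraicOver j w -> exists p, minimal_poly w p.
Proof.
case=> q q0 qw.
have ex : exists n, `[< exists p, [/\ p != 0, root (map_poly j p) w &
    size p = n] >] by exists (size q); apply/asboolP; exists q.
case: (ex_minnP ex) => n /asboolP[p [p0 pw szp]] minp.
exists p; split=> // r rw; apply: contraT; rewrite /dvdp => r0.
have: (n <= size (r %% p)%R)%N.
  apply: minp; apply/asboolP; exists (r %% p); split=> //.
  move: rw; rewrite {1}(divp_eq r p) rmorphD rmorphM /= !rootE !hornerE.
  by rewrite (eqP pw) mulr0 add0r.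
by rewrite -szp leqNgt ltn_modp p0.
Qed.

Lemma minimal_poly_size_gt1 w p : minimal_poly w p -> (1 < size p)%N.
Proof.
case=> p0 pw _; rewrite ltnNge; apply: contra p0 => /size1_polyC p_c.
move: pw; rewrite p_c map_polyC rootE hornerC fmorph_eq0 => /eqP ->.
by rewrite polyC0.
Qed.

(* Reading off an inverse from the minimal polynomial: [w * q(w) = - p(0)]. *)
Lemma algebraic_inv w : algebraicOver j w ->
  exists q : {poly F}, w^-1 = (map_poly j q).[w].
Proof.
move=> w_alg; have [->|w0] := eqVneq w 0.
  by exists 0; rewrite rmorph0 horner0 invr0.
have [p [p0 pw pmin]] := minimal_poly_exists w_alg.
have [q pE] : exists q, p = q * 'X + (p`_0)%:P.
  exists (\poly_(i < (size p).-1) p`_i.+1); apply/polyP=> i.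
  rewrite coefD coefMX coefC; case: i => [|i] /=; first by rewrite add0r.
  rewrite addr0 coef_poly; case: ltnP => // szi.
  by rewrite nth_default //; case: (size p) szi.
(* If [p] had zero constant term, the smaller polynomial [q] would vanish at [w], against
   minimality. *)
have p00 : p`_0 != 0.
  apply/eqP => p00; move: pE; rewrite p00 addr0 => pE.
  have q0 : q != 0 by apply: contraNneq p0 => q0; rewrite pE q0 mul0r.
  have : p %| q.
    apply: pmin; move: pw; rewrite pE rmorphM /= map_polyX.
    rewrite !rootE hornerM hornerX.
    by rewrite mulf_eq0 (negbTE w0) orbF.
  move/(dvdp_leq q0); rewrite pE size_mulX //.
  by rewrite ltnn.
exists (- (p`_0)^-1 *: q); rewrite map_polyZ hornerZ.
apply: (mulIf w0); rewrite mulVf //.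
move: pw; rewrite pE rmorphD rmorphM /= map_polyX map_polyC rootE !hornerE.
rewrite coefD coefMX /= add0r coefC eqxx addr_eq0 => /eqP h.
by rewrite -mulrA h rmorphN fmorphV mulrN mulNr opprK mulVf // fmorph_eq0.
Qed.

(** The inverse of an algebraic [w] is a polynomial in [w], so a subring containing the base field
    already contains it. *)
Lemma subring_inv (D : set L) :
    (forall a, D (j a)) -> (forall x y, D x -> D y -> D (x - y)) ->
    (forall x y, D x -> D y -> D (x * y)) ->
  forall w, algebraicOver j w -> D w -> D w^-1.
Proof.
move=> Dj DB DM w w_alg Dw; have [q ->] := algebraic_inv w_alg.
have D0 : D 0 by rewrite -(subrr (j 0)); apply: DB.
have DD x y : D x -> D y -> D (x + y).
  by move=> Dx Dy; rewrite -[y]opprK -[- y]sub0r; apply: (DB) => //; exact: DB.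
elim/poly_ind: q => [|q c IH]; first by rewrite rmorph0 horner0.
rewrite rmorphD rmorphM /= map_polyX map_polyC hornerMXaddC.
by apply: DD; [apply: DM | apply: Dj].
Qed.

(** This makes the map sending $q(w)$ to $q^\phi(b)$ well defined. *)
Lemma dvd_minimal_poly_root w p (phi : {rmorphism F -> L}) (b : L) :
    minimal_poly w p -> root (map_poly phi p) b ->
  forall q, (map_poly j q).[w] = 0 -> (map_poly phi q).[b] = 0.
Proof.
move=> [_ _ pmin] pb q /eqP; rewrite -rootE => /pmin /dvdpP[r ->].
by rewrite rmorphM hornerM (eqP pb) mulr0.
Qed.

End MinimalPolynomial.

Lemma horner_inj_minimal_poly (F L : fieldType) (j : {rmorphism F -> L}) w p
    (q : {poly F}) :
  minimal_poly j w p -> (map_poly j q).[w] = 0 -> (size q < size p)%N -> q = 0.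
Proof.
move=> [p0 pw pmin] /eqP qw szq; apply: contraTeq isT => q0.
by have := dvdp_leq q0 (pmin _ qw); rewrite leqNgt szq.
Qed.

(** * Extension of homomorphisms to the separable closure *)

Section PartialHomomorphisms.

Variables (K L : fieldType) (iota : {rmorphism K -> L}).

(** Containing the diagonal of [K] makes the homomorphism fix [K]. Since [G] is closed under
    subtraction, the condition at 0 amounts to single-valuedness. The domain is only required to be
    a subring. *)
Definition kgraph (G : set (L * L)) : Prop :=
  [/\ forall k, G (iota k, iota k), forall a b, G a -> G b -> G (a - b),
      forall a b, G a -> G b -> G (a * b) & forall y, G (0, y) -> y = 0].

Lemma kgraph_fun G x y y' : kgraph G -> G (x, y) -> G (x, y') -> y = y'.
Proof.
move=> [_ GB _ G0] Gy Gy'; apply/eqP; rewrite -subr_eq0; apply/eqP/G0.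
by rewrite -(subrr x); apply: GB Gy Gy'.
Qed.

(** This is the graph of the extension of [phi] to $F[w]$ that sends [w] to [b]; the first
    hypothesis says that [j] and [phi] agree on [K]. *)
Lemma kgraph_horner (F : fieldType) (j phi : {rmorphism F -> L}) w b p :
    (forall k, exists2 a, j a = iota k & phi a = iota k) ->
    minimal_poly j w p -> root (map_poly phi p) b ->
  kgraph [set ab | exists q : {poly F},
    ab = ((map_poly j q).[w], (map_poly phi q).[b])].
Proof.
move=> jphi pw pb; split.
- move=> k; have [a ja pa] := jphi k; exists a%:P.
  by rewrite !map_polyC !hornerC /= ja pa.
- move=> _ _ [q ->] [r ->]; exists (q - r).
  by rewrite !rmorphB !hornerE.
- move=> _ _ [q ->] [r ->]; exists (q * r).
  by rewrite !rmorphM !hornerE.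
- move=> y [q [/esym q0 ->]]; exact: dvd_minimal_poly_root pw pb _ q0.
Qed.

Hypothesis closure : separable_closure iota.

Lemma separable_closure_algebraic w : algebraicOver iota w.
Proof.
have [/(_ w)[p [p_irr _ pw]] _] := closure.
by exists p => //; apply: irredp_neq0.
Qed.

(** Induction principle for $K(S)$: as [L] is algebraic over [K], inverses come for free by
    [subring_inv]. *)
Lemma adjoin_minimal (S : set L) (D : set L) :
    (forall k, D (iota k)) -> (forall x y, D x -> D y -> D (x - y)) ->
    (forall x y, D x -> D y -> D (x * y)) -> (forall s, S s -> D s) ->
  forall x, x \in adjoin iota S -> D x.
Proof.
move=> DK DB DM DS x /asboolP/(_ (fun x => `[< D x >])) h.
apply/asboolP; apply: h => [|k|s Ss]; [|by apply/asboolP..|by apply/asboolP/DS].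
split; first by apply/asboolP; rewrite -(rmorph1 iota).
- by move=> y z /asboolP Dy /asboolP Dz; apply/asboolP/DB.
- move=> y z /asboolP Dy /asboolP Dz; apply/asboolP/DM => //.
  exact: (subring_inv DK DB DM (separable_closure_algebraic z)).
Qed.

(** The domain of [G] is a subring containing [K], hence a field. Thus [G] amounts to two embeddings
    of one field [F] into [L], over which minimal polynomials can be taken. *)
Lemma kgraph_field G : kgraph G ->
  exists (F : fieldType) (j phi : {rmorphism F -> L}),
    (forall k, exists2 a, j a = iota k & phi a = iota k) /\
    forall x y, G (x, y) <-> exists a, x = j a /\ y = phi a.
Proof.
move=> kG; have [GK GB GM G0] := kG.
pose D : set L := fun x => exists y, G (x, y).
have Dadj (a : adjoin_field iota D) : D (val a).
  have : val a \in adjoin iota D by apply: adjoin_valP.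
  apply: (adjoin_minimal (D := D)) => //.
  - by move=> k; exists (iota k).
  - by move=> x y [x' Gx] [y' Gy]; exists (x' - y'); apply: GB Gx Gy.
  - by move=> x y [x' Gx] [y' Gy]; exists (x' * y'); apply: GM Gx Gy.
pose f a := projT1 (cid (Dadj a)).
have fP a : G (val a, f a) by rewrite /f; case: cid.
have fE a y : G (val a, y) -> f a = y by apply: kgraph_fun kG (fP a).
have [phi phiE] : exists phi : {rmorphism adjoin_field iota D -> L},
    phi = f :> (_ -> _).
  apply: rmorphism_of.
  - by move=> a b; apply: fE; apply: GB (fP a) (fP b).
  - split; first by apply: fE; have := GK 1; rewrite rmorph1.
    by move=> a b; apply: fE; apply: GM (fP a) (fP b).
exists (adjoin_field iota D), val, phi; split=> [k|x y].
  by exists (to_adjoin iota D k) => //; rewrite phiE; apply: fE; apply: GK.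
split=> [Gxy|[a [-> ->]]]; last by rewrite phiE; apply: fP.
have Dx : D x by exists y.
have xD := mem_adjoin iota Dx.
by exists (AdjoinField xD); split=> //; rewrite phiE; apply/esym/fE.
Qed.

(** The minimal polynomial of [w] over the domain divides a separable polynomial over [K]. Its image
    under [phi] is therefore separable and has a root [b] in [L], to which [w] can be sent. *)
Lemma kgraph_step G w : kgraph G ->
  exists G', [/\ kgraph G', (G `<=` G')%classic & exists y, G' (w, y)].
Proof.
move=> /kgraph_field[F [j [phi [jphi GE]]]].
have [u uE] : exists u : {rmorphism K -> F}, forall k, j (u k) = iota k.
  pose f k := projT1 (cid2 (jphi k)).
  have fE k : j (f k) = iota k by rewrite /f; case: cid2.
  have [||u uE] := @rmorphism_of _ _ f.
  - by move=> a b; apply: (fmorph_inj j); rewrite rmorphB !fE rmorphB.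
  - split=> [|a b]; apply: (fmorph_inj j); first by rewrite fE !rmorph1.
    by rewrite rmorphM !fE rmorphM.
  - by exists u => k; rewrite uE.
have [/(_ w)[s [s_irr s_sep sw]] closed] := closure.
have usw : root (map_poly j (map_poly u s)) w.
  by rewrite -map_poly_comp (eq_map_poly uE).
have [|p pmin] := @minimal_poly_exists _ _ j w.
  by exists (map_poly u s); rewrite // map_poly_eq0 irredp_neq0.
have [||b pb] := closed (map_poly phi p).
- by rewrite size_map_poly (minimal_poly_size_gt1 pmin).
- rewrite separable_map; case: pmin => _ _ /(_ _ usw) /dvdp_separable; apply.
  by rewrite separable_map.
exists [set ab | exists q : {poly F},
    ab = ((map_poly j q).[w], (map_poly phi q).[b])]%classic; split.
- exact: kgraph_horner pmin pb.
- move=> [x y] /GE[a [-> ->]]; exists a%:P.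
  by rewrite !map_polyC !hornerC.
- by exists b, 'X; rewrite !map_polyX !hornerX.
Qed.

(** The iterates of [y] under [s] are roots of one polynomial over [K], so they repeat. Injectivity
    makes the sequence purely periodic, and [y] is then itself an image. *)
Lemma endomorphism_bijective (s : {rmorphism L -> L}) :
  (forall k, s (iota k) = iota k) -> bijective s.
Proof.
move=> sK; have s_inj : injective s by apply: fmorph_inj.
suff sur y : exists x, s x = y.
  exists (fun y => projT1 (cid (sur y))) => x; last by case: cid.
  by apply: s_inj; case: cid.
have [p p0 py] := separable_closure_algebraic y.
pose n := size p.
have : looping s y n.
  apply: contraT; rewrite -looping_uniq => uniq_y.
  have := @max_poly_roots _ (map_poly iota p) (traject s y n.+1).
  rewrite map_poly_eq0 size_traject size_map_poly => /(_ p0 _ uniq_y).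
  rewrite -/n ltnNge leqnSn; apply; apply/allP => _ /trajectP[i _ ->].
  elim: i => //= i; rewrite !rootE => /eqP ry.
  rewrite -(eq_map_poly sK) map_poly_comp horner_map /=.
  by rewrite ry rmorph0.
case/trajectP => i i_n; rewrite -(subnKC (ltnW i_n)) iterD.
have it_inj m : injective (iter m s) by elim: m => // m IH x x' /s_inj/IH.
move/it_inj; move: i_n; rewrite -subn_gt0; case: (n - i)%N => // m _ y_per.
by exists (iter m s y).
Qed.

Theorem kgraph_extension G : kgraph G ->
  exists2 sigma, Defs.Gal iota sigma & forall x y, G (x, y) -> sigma x = y.
Proof.
(* Zorn runs over the sets added to [G], so that the empty chain is harmless: its union gives [G]
   itself. *)
move=> kG; have [A [kA maxA]] :
    exists A, kgraph (G `|` A)%classic /\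
      forall B, (A `<` B)%classic -> ~ kgraph (G `|` B)%classic.
  apply: (@Zorn_bigcup _ (fun A => kgraph (G `|` A)%classic)) => F FP Ftot.
  have [[X0 FX0]|F0] := pselect (exists X, F X); last first.
    suff -> : (\bigcup_(X in F) X)%classic = set0 by rewrite setU0.
    by apply/seteqP; split=> // a [X FX]; case: F0; exists X.
  have up a b : (G `|` \bigcup_(X in F) X)%classic a ->
      (G `|` \bigcup_(X in F) X)%classic b ->
      exists2 X, F X & (G `|` X)%classic a /\ (G `|` X)%classic b.
    move=> [Ga|[X FX Xa]] [Gb|[Y FY Yb]].
    - by exists X0 => //; split; left.
    - by exists Y => //; split; [left | right].
    - by exists X => //; split; [right | left].
    - case: (Ftot X Y FX FY) => sub; [exists Y|exists X] => //.
        by split; right => //; apply: sub.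
      by split; right => //; apply: sub.
  have inj X a : F X -> (G `|` X)%classic a ->
      (G `|` \bigcup_(X in F) X)%classic a.
    by move=> FX [Ga|Xa]; [left | right; exists X].
  split.
  - by move=> k; left; case: kG.
  - move=> a b Ua Ub; have [X FX [Xa Xb]] := up a b Ua Ub.
    by apply: (inj X) => //; have [_ h _ _] := FP _ FX; apply: h.
  - move=> a b Ua Ub; have [X FX [Xa Xb]] := up a b Ua Ub.
    by apply: (inj X) => //; have [_ _ h _] := FP _ FX; apply: h.
  - move=> y Uy; have [X FX [Xy _]] := up _ _ Uy Uy.
    by have [_ _ _] := FP _ FX; apply.
(* A point outside the domain would allow a strictly larger graph by [kgraph_step]. *)
have total x : exists y, (G `|` A)%classic (x, y).
  have [G' [kG' sub [y G'y]]] := kgraph_step x kA.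
  exists y; apply: contrapT => GAy; apply: (maxA G').
    split=> [a Aa|sub']; first by apply: sub; right.
    by apply: GAy; right; apply: sub'.
  suff -> : (G `|` G')%classic = G' by [].
  by apply/seteqP; split=> a; [case=> // Ga; apply: sub; left | right].
pose f x := projT1 (cid (total x)).
have fP x : (G `|` A)%classic (x, f x) by rewrite /f; case: cid.
have fE x y : (G `|` A)%classic (x, y) -> f x = y.
  by apply: kgraph_fun kA (fP x).
have [AK AB AM _] := kA.
have [||s sE] := @rmorphism_of _ _ f.
- by move=> a b; apply: fE; apply: AB (fP a) (fP b).
- split; first by apply: fE; have := AK 1; rewrite !rmorph1.
  by move=> a b; apply: fE; apply: AM (fP a) (fP b).
have sK k : s (iota k) = iota k by rewrite sE; apply: fE.
exists s; last by move=> x y Gxy; rewrite sE; apply: fE; left.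
split=> //; first by exists s.
exact: endomorphism_bijective.
Qed.

End PartialHomomorphisms.

(** * Automorphisms of the separable closure *)

Section AbsoluteGaloisGroup.

Variables (K L : fieldType) (iota : {rmorphism K -> L}).
Implicit Types (sigma : L -> L).

Lemma Gal_rmorphism sigma : Defs.Gal iota sigma ->
  exists2 s : {rmorphism L -> L}, sigma = s & forall k, s (iota k) = iota k.
Proof. by case=> -[s ->] _ sK; exists s. Qed.

Lemma Gal_inv sigma : Defs.Gal iota sigma ->
  exists2 sigma', Defs.Gal iota sigma' &
    cancel sigma sigma' /\ cancel sigma' sigma.
Proof.
case=> -[s ->] [s' sK s'K] siota; exists s' => //; split.
- have [||t tE] := @rmorphism_of _ _ s'; last by exists t.
    by move=> a b; apply: (fmorph_inj s); rewrite rmorphB !s'K.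
  split=> [|a b]; apply: (fmorph_inj s); first by rewrite s'K rmorph1.
  by rewrite rmorphM !s'K.
- by exists s.
- by move=> a; rewrite -{1}[iota a]siota sK.
Qed.

Lemma Gal_comp sigma sigma' :
  Defs.Gal iota sigma -> Defs.Gal iota sigma' ->
  Defs.Gal iota (sigma \o sigma').
Proof.
move=> [[s ->] s_bij sK] [[s' ->] s'_bij s'K]; split.
- by exists (s \o s').
- exact: bij_comp.
- by move=> a /=; rewrite s'K sK.
Qed.

Hypothesis closure : separable_closure iota.

Lemma Gal_eq_adjoin sigma sigma' (S : set L) :
    Defs.Gal iota sigma -> Defs.Gal iota sigma' ->
    (forall s, S s -> sigma s = sigma' s) ->
  forall x, x \in adjoin iota S -> sigma x = sigma' x.
Proof.
move=> /Gal_rmorphism[s -> sK] /Gal_rmorphism[s' -> s'K] eqS x.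
apply: (adjoin_minimal closure (D := fun x => s x = s' x)) => //.
- by move=> k; rewrite sK s'K.
- by move=> y z eqy eqz; rewrite !rmorphB eqy eqz.
- by move=> y z eqy eqz; rewrite !rmorphM eqy eqz.
Qed.

Lemma Gal_adjoin_stable sigma (S : set L) : Defs.Gal iota sigma ->
    (forall s, S s -> sigma s \in adjoin iota S) ->
  forall x, x \in adjoin iota S -> sigma x \in adjoin iota S.
Proof.
move=> /Gal_rmorphism[s -> sK] stS x.
apply: (adjoin_minimal closure (D := fun x => s x \in adjoin iota S)) => //.
- by move=> k; rewrite sK base_adjoin.
- by move=> y z Dy Dz; rewrite rmorphB rpredB.
- by move=> y z Dy Dz; rewrite rmorphM rpredM.
Qed.

(** Write the minimal polynomial as $q\cdot(X-c)$. If [q] is not constant, some automorphism sends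
    [c] to a root [b] of [q]; then $b=c$ is a double root, against separability. Otherwise the
    polynomial is linear and [c] is read off its coefficients. *)
Lemma Gal_fixed c : (forall sigma, Defs.Gal iota sigma -> sigma c = c) ->
  exists k, c = iota k.
Proof.
move=> c_fix; have c_alg := separable_closure_algebraic closure c.
have [p pmin] := minimal_poly_exists c_alg.
have [p0 pc p_dvd] := pmin.
have p_sep : separable_poly p.
  have [/(_ c)[s [_ s_sep sc]] _] := closure.
  exact: dvdp_separable (p_dvd s sc) s_sep.
have [q pE] := factor_theorem _ _ pc.
have q0 : q != 0.
  by apply: contraNneq p0 => q0; rewrite -(map_poly_eq0 iota) pE q0 mul0r.
have szp : size p = (size q).+1.
  rewrite -(size_map_poly iota) pE.
  by rewrite size_Mmonic ?monicXsubC // size_XsubC addn2.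
have [q_gt1|q_le1] := ltnP 1 (size q).
  have [_ /(_ q q_gt1)[|b qb]] := closure.
    apply: (dvdp_separable (p := map_poly iota p));
      last by rewrite separable_map.
    by rewrite pE dvdp_mulr.
  have pb : root (map_poly iota p) b by rewrite pE rootM qb.
  have [|sigma sG sigmaE] := kgraph_extension closure
    (kgraph_horner (iota := iota) _ pmin pb); first by move=> k; exists k.
  have cb : sigma c = b.
    by apply: sigmaE; exists 'X; rewrite !map_polyX !hornerX.
  rewrite c_fix // in cb; have := separable_nosquare (u := 'X - c%:P) (k := 2)
    (p := map_poly iota p).
  rewrite separable_map size_XsubC => /(_ p_sep isT isT).
  have [r qE] := factor_theorem _ _ qb.
  by rewrite pE qE -cb -mulrA -expr2 dvdp_mull.
have szq1 : size q = 1 by apply/eqP; rewrite eqn_leq q_le1 size_poly_gt0.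
have p1 : p`_1 != 0 by move: p0; rewrite -lead_coef_eq0 lead_coefE szp szq1.
exists (- (p`_0 / p`_1)).
move: pc; rewrite rootE horner_coef size_map_poly szp szq1.
rewrite big_ord_recl big_ord1 /= expr0 mulr1 expr1 !coef_map addr_eq0.
move=> /eqP pc.
apply: (mulfI (x := iota p`_1)); rewrite ?fmorph_eq0 //.
by rewrite -rmorphM mulrN [p`_1 * _]mulrC divfK // rmorphN pc opprK.
Qed.

End AbsoluteGaloisGroup.

(** * Torsion points and roots of unity *)

Lemma ffun_exprE (I : finType) (L : fieldType) (x : {ffun I -> L}) n i :
  (x ^+ n) i = x i ^+ n.
Proof. by elim: n => [|n IH]; rewrite ?expr0 ?exprS ffunE ?IH. Qed.

(* Multiplication by [a] permutes the finite set [S] of monomials in the [x i],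
   so [a ^+ #|S| = 1]: [S] consists of [#|S|] roots of unity of order [#|S|]. *)
Lemma torsion_primitive_root (L : fieldType) (N : nat) (x : {ffun 'I_N -> L}) :
    torsion_point x ->
  exists e w, [/\ (0 < e)%N, e.-primitive_root w,
    exists c : 'I_N -> nat, w = \prod_i x i ^+ c i
    & forall i, exists k, x i = w ^+ k].
Proof.
case=> -[//|n] _ xn.
have {}xn i : x i ^+ n.+1 = 1 by rewrite -ffun_exprE xn ffunE.
have x0 i : x i != 0.
  by apply: contra_eqN (xn i) => /eqP ->; rewrite expr0n eq_sym oner_eq0.
(* Exponents matter only modulo [n.+1], so this finite family yields every monomial. *)
pose g (c : {ffun 'I_N -> 'I_n.+1}) := \prod_i x i ^+ c i.
pose S := undup (codom g); pose e := size S.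
have memS (c : 'I_N -> nat) : \prod_i x i ^+ c i \in S.
  rewrite mem_undup; apply/codomP.
  exists [ffun i => inord (c i %% n.+1)]; apply: eq_bigr => i _.
  by rewrite ffunE inordK ?ltn_pmod // expr_mod.
have SP a : reflect (exists c : 'I_N -> nat, a = \prod_i x i ^+ c i) (a \in S).
  apply: (iffP idP) => [|[c ->] //]; rewrite mem_undup => /codomP[c ->].
  by exists (fun i => nat_of_ord (c i)).
have S0 a : a \in S -> a != 0.
  case/SP=> c ->; rewrite prodf_seq_neq0.
  by apply/allP => i _; rewrite expf_neq0.
have Suniq : uniq S by apply: undup_uniq.
have Smul a b : a \in S -> b \in S -> a * b \in S.
  move=> /SP[c ->] /SP[d ->]; rewrite -big_split /=.
  by under eq_bigr do rewrite -exprD; apply: memS.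
have Sunity a : a \in S -> a ^+ e = 1.
  move=> aS; have : perm_eq [seq a * b | b <- S] S.
    have Muniq : uniq [seq a * b | b <- S].
      by rewrite map_inj_uniq //; apply: mulfI; apply: S0.
    apply: uniq_perm => //.
    have [||//] := uniq_min_size (s2 := S) Muniq; last by rewrite size_map.
    by move=> _ /mapP[b bS ->]; apply: Smul.
  move=> perm_aS; have prodS0 : \prod_(b <- S) b != 0.
    by rewrite prodf_seq_neq0; apply/allP => b; apply: S0.
  apply: (mulIf prodS0); rewrite mul1r -{2}(perm_big _ perm_aS) big_map.
  by rewrite big_split big_const_seq count_predT iter_mulr_1.
have S1 : 1 \in S by apply/SP; exists (fun _ => 0%N); rewrite big1.
have e_gt0 : (0 < e)%N by rewrite /e; case: (S) S1.
have /hasP[w wS w_prim] : has e.-primitive_root S.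
  apply: has_prim_root => //; apply/allP => a aS.
  by rewrite unity_rootE Sunity.
exists e, w; split=> //; first exact/SP.
move=> i; have /Sunity : x i \in S.
  apply/SP; exists (fun k => k == i : nat); rewrite (bigD1 i) //= eqxx expr1.
  by rewrite big1 ?mulr1 // => k /negbTE ->.
by case/(prim_rootP w_prim) => k ->; exists k.
Qed.

(** * Degrees and roots of unity *)

Section ExtensionDegree.

Variables (K L : fieldType) (iota : {rmorphism K -> L}).

(** Expressing each family in the other gives matrices with $AB=1$ of size [m], by freeness of [b];
    a rank count over [L] concludes. *)
Lemma is_basis_leq (S : set L) (F : {pred L}) m n (b : 'I_m -> L)
    (b' : 'I_n -> L) :
  is_basis (adjoin iota S) F b -> is_basis (adjoin iota S) F b' -> (m <= n)%N.
Proof.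
move=> [Fb b_free b_span] [Fb' _ b'_span].
have /choice[C CP] i : exists c : 'I_n -> L,
    (forall j, c j \in adjoin iota S) /\ b i = \sum_j c j * b' j.
  by have [c cE bE] := b'_span _ (Fb i); exists c.
have /choice[D DP] j : exists c : 'I_m -> L,
    (forall k, c k \in adjoin iota S) /\ b' j = \sum_k c k * b k.
  by have [c cE bE] := b_span _ (Fb' j); exists c.
pose A : 'M[L]_(m, n) := \matrix_(i, j) C i j.
pose B : 'M[L]_(n, m) := \matrix_(j, k) D j k.
apply: (@mulmx1_min _ _ _ A B); apply/matrixP => i k; rewrite [RHS]mxE.
apply/eqP; rewrite -subr_eq0; apply/eqP.
apply: (b_free (fun k => (A *m B) i k - (i == k)%:R)) => [l|].
  rewrite rpredB ?rpred_nat // mxE rpred_sum // => j _.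
  by rewrite !mxE rpredM //; [have [] := CP i | have [] := DP j].
under eq_bigr do rewrite mulrBl; rewrite sumrB.
have -> : \sum_l (i == l)%:R * b l = b i.
  rewrite (bigD1 i) //= eqxx mul1r big1 ?addr0 // => l.
  by rewrite eq_sym => /negbTE ->; rewrite mul0r.
apply/eqP; rewrite subr_eq0; apply/eqP.
have [_ ->] := CP i; under eq_bigr do rewrite mxE mulr_suml.
rewrite exchange_big; apply: eq_bigr => j _; have [_ ->] := DP j.
by rewrite mulr_sumr; apply: eq_bigr => l _; rewrite !mxE mulrA.
Qed.

Lemma ext_degree_basis (S : set L) (F : {pred L}) n (b : 'I_n -> L) :
  is_basis (adjoin iota S) F b -> ext_degree (adjoin iota S) F = n.
Proof.
move=> b_basis; apply: xget_unique => [|m [b' b'_basis]]; first by exists b.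
apply/eqP; rewrite eqn_leq (is_basis_leq b'_basis b_basis).
exact: is_basis_leq b_basis b'_basis.
Qed.

Hypothesis closure : separable_closure iota.

(** The hypotheses say that $K(T)=K(S)(w)$, so the powers of [w] below the degree of [p] form a
    basis. *)
Lemma ext_degree_minimal_poly (S T : set L) (w : L)
    (p : {poly adjoin_field iota S}) :
    minimal_poly val w p -> (forall s, S s -> s \in adjoin iota T) ->
    w \in adjoin iota T ->
    (forall t, T t -> exists q : {poly adjoin_field iota S},
      t = (map_poly val q).[w]) ->
  ext_degree (adjoin iota S) (adjoin iota T) = (size p).-1.
Proof.
move=> pmin ST wT Tw; have [p0 /rootP pw _] := pmin.
apply: (ext_degree_basis (b := fun i => w ^+ i)); split=> [i|c cS c0|x xT].
- exact: rpredX.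
- pose a i := AdjoinField (cS i).
  (* The coefficients are indexed by ordinals; [insub] extends them by 0 to all naturals. *)
  pose q := \poly_(i < (size p).-1) oapp a 0 (insub i).
  have q0 : q = 0.
    apply: (horner_inj_minimal_poly pmin).
      rewrite -[RHS]c0 (horner_coef_wide (n := (size p).-1)); last first.
        by rewrite size_map_poly size_poly.
      by apply: eq_bigr => i _; rewrite coef_map coef_poly ltn_ord valK.
    apply: leq_ltn_trans (size_poly _ _) _.
    by rewrite prednK // size_poly_gt0.
  move=> i; have := coef0 (adjoin_field iota S) i.
  by rewrite -q0 coef_poly ltn_ord valK => /(congr1 val).
- have [q ->] : exists q : {poly adjoin_field iota S}, x = (map_poly val q).[w].
    move: xT; apply: (adjoin_minimal closure (D := fun x =>
      exists q : {poly adjoin_field iota S}, x = (map_poly val q).[w])) => //.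
    + move=> k; exists (to_adjoin iota S k)%:P.
      by rewrite map_polyC hornerC.
    + move=> _ _ [q ->] [r ->]; exists (q - r).
      by rewrite rmorphB hornerD hornerN.
    + by move=> _ _ [q ->] [r ->]; exists (q * r); rewrite rmorphM hornerM.
  (* The coordinates of $q(w)$ are the coefficients of the remainder modulo [p]. *)
  exists (fun i => val (q %% p)`_i) => [i|]; first exact: adjoin_valP.
  have -> : (map_poly val q).[w] = (map_poly val (q %% p)).[w].
    rewrite {1}(divp_eq q p) rmorphD rmorphM hornerD hornerM /=.
    by rewrite pw mulr0 add0r.
  rewrite (horner_coef_wide (n := (size p).-1)).
    by apply: eq_bigr => i _; rewrite coef_map.
  by rewrite size_map_poly -ltnS prednK ?ltn_modp // size_poly_gt0.
Qed.

End ExtensionDegree.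

Lemma map_poly_Xn_sub1 (F L : nzRingType) (j : {rmorphism F -> L}) n :
  map_poly j ('X^n - 1) = 'X^n - 1.
Proof. by rewrite rmorphB rmorphXn rmorph1 /= map_polyX. Qed.

(** $X^e-1$ is the product of the distinct factors $X-w^i$, so a divisor is a subproduct up to a
    scalar. *)
Lemma dvdp_Xn_sub1_split (L : fieldType) e (w : L) (p : {poly L}) :
    e.-primitive_root w -> p %| 'X^e - 1 ->
  exists rs : seq L,
    [/\ uniq rs, forall r, r \in rs = root p r & size rs = (size p).-1].
Proof.
move=> w_prim; rewrite -(factor_Xn_sub_1 w_prim) => /dvdp_prod_XsubC[m].
set r0 := mask m _ => pE; exists [seq w ^+ i | i <- r0].
have rsE r : (r \in [seq w ^+ i | i <- r0]) = root p r.
  by rewrite (eqp_root pE) -(big_map (fun i => w ^+ i) xpredT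
    (fun r => 'X - r%:P)) root_prod_XsubC.
split=> //.
- rewrite map_inj_in_uniq ?mask_uniq ?iota_uniq // => i j.
  move=> /mem_mask i_e /mem_mask j_e /eqP.
  rewrite (eq_prim_root_expr w_prim) => /eqP.
  rewrite !modn_small //; first by move: j_e; rewrite mem_index_iota.
  by move: i_e; rewrite mem_index_iota.
- by rewrite size_map (eqp_size pE) size_prod_XsubC.
Qed.

(** * Galois orbits of torsion points *)

Section TorusAction.

Variables (R : idomainType) (L : fieldType) (N : nat).
Variable iota : {rmorphism {fraction R} -> L}.
Implicit Types (f : laurent R N) (x y : {ffun 'I_N -> L}) (sigma : L -> L).

Lemma Gal_monomial sigma x m : Defs.Gal iota sigma ->
  monomial [ffun i => sigma (x i)] m = sigma (monomial x m).
Proof.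
case/Gal_rmorphism=> s -> _; rewrite rmorph_prod; apply: eq_bigr => i _.
by rewrite ffunE fmorphXz.
Qed.

Lemma monomialX x k m : monomial [ffun i => x i ^+ k] m = monomial x m ^+ k.
Proof.
rewrite /monomial -prodrXl; apply: eq_bigr => i _.
by rewrite ffunE !exprnP exprzAC.
Qed.

Lemma Gal_leval sigma f x : Defs.Gal iota sigma ->
  leval iota f [ffun i => sigma (x i)] = sigma (leval iota f x).
Proof.
move=> sG; rewrite /leval; under eq_bigr do rewrite Gal_monomial //.
case/Gal_rmorphism: sG => s -> sK; rewrite rmorph_sum; apply: eq_bigr => m _.
by rewrite rmorphM sK.
Qed.

(** All coordinates are powers of one root of unity [w], and [sigma] sends [w] to some $w^k$; the
    same [k] serves every coordinate. *)
Lemma Gal_torsion sigma x : torsion_point x -> Defs.Gal iota sigma ->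
  exists k, forall i, sigma (x i) = x i ^+ k.
Proof.
move=> /torsion_primitive_root[e [w [_ w_prim _ xw]]] /Gal_rmorphism[s -> _].
have [|k swE] := prim_rootP w_prim (x := s w).
  by rewrite -rmorphXn (prim_expr_order w_prim) rmorph1.
exists k => i; have [j ->] := xw i.
by rewrite rmorphXn swE -!exprM mulnC.
Qed.

(** By [Gal_torsion] the orbit lies among the finitely many powers of [x]. *)
Lemma orbit_exists x : torsion_point x ->
  exists O : {fset {ffun 'I_N -> L}}, forall y,
    y \in O = `[< conjugate_points iota x y >].
Proof.
move=> x_tors; have [[//|n] _ xn] := x_tors.
pose g (k : 'I_n.+1) := [ffun i => x i ^+ k].
exists [fset y in codom g | `[< conjugate_points iota x y >]]%fset => y.
rewrite !inE; apply: andb_idl => /asboolP[sigma /(Gal_torsion x_tors)[k sE] ->].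
apply/codomP; exists (inord (k %% n.+1)); apply/ffunP => i.
rewrite !ffunE inordK ?ltn_pmod // sE expr_mod //.
by rewrite -ffun_exprE xn ffunE.
Qed.

Hypothesis closure : separable_closure iota.

(** Normality of $K(x^M)$: [sigma] raises each monomial in [x] to a fixed power. *)
Lemma Gal_support_stable sigma f x : torsion_point x -> Defs.Gal iota sigma ->
  forall a, a \in adjoin iota (support_values f x) ->
    sigma a \in adjoin iota (support_values f x).
Proof.
move=> x_tors sG; apply: (Gal_adjoin_stable closure sG) => _ [m fm ->].
have [k sE] := Gal_torsion x_tors sG.
rewrite -Gal_monomial // (_ : [ffun i => _] = [ffun i => x i ^+ k]).
  by rewrite monomialX rpredX // mem_adjoin //; exists m.
by apply/ffunP=> i; rewrite !ffunE.
Qed.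

Lemma Gal_restrict sigma f x : torsion_point x -> Defs.Gal iota sigma ->
  exists2 tau, Defs.Gal (to_adjoin iota (support_values f x)) tau &
    forall a, val (tau a) = sigma (val a).
Proof.
move=> x_tors sG; have [sigma' s'G [sK s'K]] := Gal_inv sG.
pose A := adjoin_field iota (support_values f x).
pose res s (sG : Defs.Gal iota s) (a : A) : A :=
  AdjoinField (Gal_support_stable x_tors sG (adjoin_valP a)).
exists (res _ sG) => //; split.
- case/Gal_rmorphism: (sG) => s sE _.
  have [||t tE] := @rmorphism_of _ _ (res _ sG); last by exists t.
    by move=> a b; apply: val_inj; rewrite /= sE rmorphB.
  by split=> [|a b]; apply: val_inj; rewrite /= sE ?rmorph1 // rmorphM.
- by exists (res _ s'G) => a; apply: val_inj; rewrite /= ?sK ?s'K.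
- case/Gal_rmorphism: (sG) => s sE sK0 a; apply: val_inj.
  by rewrite /= sE sK0.
Qed.

(** Here [kgraph_horner] is applied to the two embeddings [val] and [val \o t] of $K(S)$. *)
Lemma Gal_lift (S : set L)
    (t : {rmorphism adjoin_field iota S -> adjoin_field iota S}) w p b :
    (forall a, t (to_adjoin iota S a) = to_adjoin iota S a) ->
    minimal_poly val w p -> root (map_poly (val \o t) p) b ->
  exists2 sigma, Defs.Gal iota sigma &
    sigma w = b /\ forall a, sigma (val a) = val (t a).
Proof.
move=> tK pmin pb.
have [|sigma sG sigmaE] := kgraph_extension closure
    (kgraph_horner (iota := iota) _ pmin pb).
  by move=> k; exists (to_adjoin iota S k) => //=; rewrite tK.
exists sigma => //; split=> [|a]; apply: sigmaE.
  by exists 'X; rewrite !map_polyX !hornerX.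
by exists a%:P; rewrite !map_polyC !hornerC.
Qed.

Lemma Gal_extend (S : set L) tau : Defs.Gal (to_adjoin iota S) tau ->
  exists2 sigma, Defs.Gal iota sigma & forall a, sigma (val a) = val (tau a).
Proof.
case=> -[t ->] _ tK.
(* Only the action on $K(S)$ matters, so [Gal_lift] is used with the trivial choice $w=b=0$. *)
have Xmin : minimal_poly (val : adjoin_field iota S -> L) 0 ('X - 0%:P).
  split; first by rewrite polyXsubC_eq0.
    by rewrite map_polyXsubC rmorph0 root_XsubC.
  by move=> q; rewrite dvdp_XsubCl -(fmorph_root val) rmorph0.
have [//||sigma sG [_ sA]] := @Gal_lift S t 0 _ 0 _ Xmin; last by exists sigma.
by rewrite map_polyXsubC rmorph0 root_XsubC.
Qed.

Lemma monomial_adjoin_coordinates f x m :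
  monomial x m \in adjoin iota (coordinates x).
Proof.
apply: rpred_prod => i _; have xi : x i \in adjoin iota (coordinates x).
  by apply: mem_adjoin; exists i.
by case: (m i) => k; [apply: rpredX | apply: rpredXN].
Qed.

Section OrbitProduct.

Variables (f : laurent R N) (x : {ffun 'I_N -> L}).
Variable O : {fset {ffun 'I_N -> L}}.
Hypothesis x_tors : torsion_point x.
Hypothesis OE : forall y, y \in O = `[< conjugate_points iota x y >].

Local Notation A := (adjoin_field iota (support_values f x)).

Let extends (y : {ffun 'I_N -> L}) (tau : A -> A) : Prop :=
  exists2 sigma, Defs.Gal iota sigma &
    y = [ffun i => sigma (x i)] /\ forall a, sigma (val a) = val (tau a).

(* The conjugates of [x] inducing a given [tau] correspond to the roots of the
   image under [tau] of the minimal polynomial of [w] over [K(x^M)], where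
   [K(x) = K(w)] for a root of unity [w]. *)
Lemma size_orbit_fibre tau :
  Defs.Gal (to_adjoin iota (support_values f x)) tau ->
  count (fun y => `[< extends y tau >]) O = Cexp iota f x.
Proof.
case=> -[t ->] _ tK.
have [e [w [e_gt0 w_prim [c wE] xw]]] := torsion_primitive_root x_tors.
have [k kE] := choice xw.
have we : root (map_poly (val : A -> L) ('X^e - 1)) w.
  by rewrite map_poly_Xn_sub1 rootE !hornerE (prim_expr_order w_prim) subrr.
have Xe0 : 'X^e - 1 != 0 :> {poly A} by rewrite monic_neq0 ?monicXnsubC.
have [|p pmin] := @minimal_poly_exists A L val w; first by exists ('X^e - 1).
have [_ _ p_dvd] := pmin.
have [|rs [rs_uniq rsE rs_size]] :=
  dvdp_Xn_sub1_split (p := map_poly (val \o t) p) w_prim.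
  by have := p_dvd _ we; rewrite -(dvdp_map (val \o t)) map_poly_Xn_sub1.
have <- : size rs = Cexp iota f x.
  rewrite rs_size size_map_poly; apply/esym.
  apply: (ext_degree_minimal_poly closure pmin).
  - by move=> _ [m _ ->]; apply: monomial_adjoin_coordinates.
  - rewrite wE rpred_prod // => i _.
    by rewrite rpredX // mem_adjoin //; exists i.
  - by move=> _ [i ->]; exists 'X^(k i); rewrite map_polyXn hornerXn.
pose pt (r : L) : {ffun 'I_N -> L} := [ffun i => r ^+ k i].
(* Each root [r] is $\sigma(w)$ for an extension $\sigma$ of [t], and [pt r] is the conjugate
   $\sigma(x)$. *)
have rsP r : r \in rs -> exists2 sigma, Defs.Gal iota sigma &
    [/\ sigma w = r, pt r = [ffun i => sigma (x i)] &
      forall a, sigma (val a) = val (t a)].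
  rewrite rsE => pr; have [sigma sG [sw sA]] := Gal_lift tK pmin pr.
  exists sigma => //; split=> //; apply/ffunP=> i; rewrite !ffunE kE -sw.
  by case/Gal_rmorphism: sG => s -> _; rewrite rmorphXn.
(* The monomial expressing [w] in [x] recovers [r] from [pt r], so [pt] is injective on the
   roots. *)
have ptK : {in rs, cancel pt (fun y : {ffun 'I_N -> L} => \prod_i y i ^+ c i)}.
  move=> r /rsP[sigma /Gal_rmorphism[s -> _] [<- -> _]].
  rewrite [in RHS]wE rmorph_prod; apply: eq_bigr => i _.
  by rewrite ffunE rmorphXn.
rewrite -size_filter -(size_map pt); apply/perm_size/uniq_perm.
- by rewrite filter_uniq // fset_uniq.
- by rewrite map_inj_in_uniq //; apply: can_in_inj ptK.
move=> y; rewrite mem_filter OE; apply/idP/mapP.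
  case/andP => /asboolP[sigma sG [yE sA]] _; exists (sigma w).
    rewrite rsE; case/Gal_rmorphism: sG sA => s -> _ sA.
    rewrite -(eq_map_poly sA) map_poly_comp rootE horner_map.
    by have [_ /rootP -> _] := pmin; rewrite rmorph0.
  apply/ffunP=> i; rewrite yE !ffunE kE.
  by case/Gal_rmorphism: sG => s -> _; rewrite rmorphXn.
case=> r /rsP[sigma sG [_ ptE sA]] ->; apply/andP; split; apply/asboolP.
  by exists sigma.
by exists sigma.
Qed.

(** Split the orbit by the automorphism [tau] that each conjugate induces on $K(x^M)$. On each fibre
    [f] is constantly $\tau(f(x))$, and every fibre has [Cexp iota f x] points. [T] lists the Galois
    group, which is finite as an image of the orbit. *)
Lemma prod_orbit :
  exists2 T : {fset (A -> A)},
    (forall tau, tau \in T =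
      `[< Defs.Gal (to_adjoin iota (support_values f x)) tau >]) &
    \prod_(y <- O) leval iota f y =
      (\prod_(tau <- T) val (tau (AdjoinField (leval_adjoin iota f x))))
        ^+ Cexp iota f x.
Proof.
pose E := to_adjoin iota (support_values f x).
have ext_exists y : y \in O -> exists tau, Defs.Gal E tau /\ extends y tau.
  rewrite OE => /asboolP[sigma sG ->].
  have [tau tG tauE] := Gal_restrict f x_tors sG.
  by exists tau; split=> //; exists sigma => //; split.
(* Two automorphisms with the same value at [x] agree on its monomials, hence on $K(x^M)$. *)
have ext_fun y tau tau' : extends y tau -> extends y tau' -> tau = tau'.
  move=> [sigma sG [-> sA]] [sigma' s'G [eqs s'A]].
  apply/funext => a; apply: val_inj; rewrite -sA -s'A.
  apply: (Gal_eq_adjoin closure sG s'G (S := support_values f x));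
    last exact: adjoin_valP.
  by move=> _ [m _ ->]; rewrite -!Gal_monomial // eqs.
have /choice[h hP] y : exists tau, y \in O -> Defs.Gal E tau /\ extends y tau.
  by have [/ext_exists[tau]|_] := boolP (y \in O); [exists tau | exists id].
exists [fset h y | y in O]%fset.
  move=> tau; apply/imfsetP/asboolP => [[y yO ->]|tauG].
    by have [] := hP y.
  have [sigma sG sA] := Gal_extend tauG.
  have yO : [ffun i => sigma (x i)] \in O.
    by rewrite OE; apply/asboolP; exists sigma.
  exists [ffun i => sigma (x i)] => //; apply: ext_fun (hP _ yO).2.
  by exists sigma.
rewrite (partition_big_imfset _ h) -prodrXl.
apply: eq_big_seq => tau /imfsetP[y0 y0O tauE].
have [tauG _] := hP _ y0O; rewrite -tauE in tauG.
rewrite -(size_orbit_fibre tauG).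
have hE y : y \in O -> (h y == tau) = `[< extends y tau >].
  move=> yO; have [_ hy] := hP _ yO; apply/eqP/asboolP => [<- //|].
  exact: ext_fun.
rewrite (eq_in_count (a2 := fun y => h y == tau)) => [|y yO];
  last by rewrite hE.
rewrite -big_filter (eq_big_seq (fun _ =>
  val (tau (AdjoinField (leval_adjoin iota f x))))).
  by rewrite big_const_seq count_predT iter_mulr_1 size_filter.
move=> y; rewrite mem_filter => /andP[hy yO]; rewrite hE // in hy.
by have /asboolP[sigma sG [-> <-]] := hy; rewrite Gal_leval.
Qed.

End OrbitProduct.

(** [Cf] is a finitely supported product over a set; an explicit finite list of that set turns it
    into an ordinary product. *)
Lemma Cf_enum f x
    (T : {fset (adjoin_field iota (support_values f x) ->
                adjoin_field iota (support_values f x))}) :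
    (forall tau, tau \in T =
      `[< Defs.Gal (to_adjoin iota (support_values f x)) tau >]) ->
  Cf iota f x =
    \prod_(tau <- T) val (tau (AdjoinField (leval_adjoin iota f x))).
Proof.
move=> TE; rewrite /Cf (fsbig_fwiden (enum_fset T)) ?fset_uniq //.
  by move=> tau tauG /=; rewrite TE; apply/asboolP.
by move=> tau /= []; rewrite TE => /asboolP.
Qed.

Lemma Cf_prod_orbit f x (O : {fset {ffun 'I_N -> L}}) :
    torsion_point x -> (forall y, y \in O = `[< conjugate_points iota x y >]) ->
  \prod_(y <- O) leval iota f y = Cf iota f x ^+ Cexp iota f x.
Proof.
move=> x_tors OE; have [T TE ->] := prod_orbit f x_tors OE.
by rewrite (Cf_enum TE).
Qed.

(** The restriction [rho] of [sigma] to $K(x^M)$ permutes the Galois group by composition, and so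
    permutes the factors. *)
Lemma Gal_Cf f x sigma : torsion_point x -> Defs.Gal iota sigma ->
  sigma (Cf iota f x) = Cf iota f x.
Proof.
move=> x_tors sG; have [O OE] := orbit_exists x_tors.
have [T TE _] := prod_orbit f x_tors OE.
pose a := AdjoinField (leval_adjoin iota f x).
have -> : Cf iota f x = \prod_(tau <- T) val (tau a) by apply: Cf_enum.
have [rho rhoG rhoE] := Gal_restrict f x_tors sG.
have rhoT_uniq : uniq [seq rho \o tau | tau <- T].
  rewrite map_inj_uniq; first exact: fset_uniq.
  have [_ /bij_inj rho_inj _] := rhoG.
  move=> tau tau' eq_tau; apply/funext => b; apply: rho_inj.
  exact: (congr1 (@^~ b) eq_tau).
have perm_T : perm_eq [seq rho \o tau | tau <- T] T.
  apply: (uniq_perm rhoT_uniq); first exact: fset_uniq.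
  have [||//] := uniq_min_size (s2 := T) rhoT_uniq; last by rewrite size_map.
  move=> _ /mapP[tau + ->]; rewrite !TE => /asboolP tauG; apply/asboolP.
  exact: Gal_comp.
rewrite -[RHS](perm_big _ perm_T) big_map.
have [s sE _] := Gal_rmorphism sG; rewrite sE rmorph_prod.
by apply: eq_bigr => tau _; rewrite -sE -rhoE.
Qed.

(** Coefficients lie in [R], and monomials at [x] are roots of the monic $X^n-1$. *)
Lemma leval_integral f x : torsion_point x ->
  integralOver (iota \o @tofrac R) (leval iota f x).
Proof.
move=> [n n_gt0 xn]; rewrite /leval.
elim/big_ind: _ => [|u v|m _]; first exact: integral0.
  exact: integral_add.
apply: integral_mul; first exact: integral_id.
exists ('X^n - 1); first exact: monicXnsubC.
rewrite map_poly_Xn_sub1.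
rewrite rootE !hornerE -monomialX subr_eq0 /monomial big1 // => i _.
by rewrite ffunE -ffun_exprE xn ffunE exp1rz.
Qed.

Lemma Cf_in_base f x : integrally_closed R -> torsion_point x ->
  in_base iota (Cf iota f x).
Proof.
move=> R_closed x_tors.
have [k CfE] := Gal_fixed closure (fun sigma => @Gal_Cf f x sigma x_tors).
have : integralOver (iota \o @tofrac R) (Cf iota f x).
  have [O OE] := orbit_exists x_tors.
  have [T TE _] := prod_orbit f x_tors OE; rewrite (Cf_enum TE) big_seq.
  elim/big_ind: _ => [|u v|tau]; [exact: integral1 | exact: integral_mul |].
  rewrite TE => /asboolP/Gal_extend[sigma /Gal_rmorphism[s -> sK] <- /=].
  (* As [s] fixes [K], it carries an integral equation of $f(x)$ to one of its conjugate. *)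
  rewrite (_ : iota \o _ = s \o (iota \o @tofrac R)); last first.
    by apply/funext => r /=; rewrite sK.
  by apply: integral_rmorph; apply: leval_integral.
rewrite CfE => -[p p_monic]; rewrite map_poly_comp fmorph_root => pk.
have [|r ->] := R_closed k; last by exists r.
by exists p.
Qed.

Lemma in_base_prod (I : Type) (s : seq I) (P : pred I) (F : I -> L) :
  (forall i, P i -> in_base iota (F i)) ->
  in_base iota (\prod_(i <- s | P i) F i).
Proof.
move=> FP; elim/big_ind: _ => //; first by exists 1; rewrite !rmorph1.
by move=> _ _ [a ->] [b ->]; exists (a * b); rewrite !rmorphM.
Qed.

Lemma in_baseX a n : in_base iota a -> in_base iota (a ^+ n).
Proof. by case=> r ->; exists (r ^+ n); rewrite !rmorphXn. Qed.

Lemma conjugate_points_joint x y z : conjugate_points iota x z ->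
  conjugate_points iota y z -> conjugate_points iota x y.
Proof.
move=> [sigma sG zE] [sigma' s'G]; have [rho rhoG [s'K rhoK]] := Gal_inv s'G.
rewrite zE => /ffunP eqxy; exists (rho \o sigma); first exact: Gal_comp.
by apply/ffunP => i; have := eqxy i; rewrite !ffunE /= => ->; rewrite s'K.
Qed.

Lemma conjugate_leval_eq0 f x y : conjugate_points iota x y ->
  (leval iota f y == 0) = (leval iota f x == 0).
Proof.
case=> sigma sG ->; rewrite Gal_leval //.
by case/Gal_rmorphism: sG => s -> _; rewrite fmorph_eq0.
Qed.

(** With [sigma] acting on [x] as a power [k] and its inverse as a power [l], the points [x] and [y]
    are powers of each other. *)
Lemma conjugate_generates x y (H : {fset {ffun 'I_N -> L}}) :
    torsion_point x -> generates x H -> conjugate_points iota x y ->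
  generates y H.
Proof.
move=> x_tors xH [sigma sG ->]; have [rho rhoG [_ rhoK]] := Gal_inv sG.
have [k sE] := Gal_torsion x_tors sG; have [l rhoE] := Gal_torsion x_tors rhoG.
have xE i : x i = sigma (x i) ^+ l.
  rewrite -{1}[x i]rhoK rhoE.
  by case/Gal_rmorphism: sG => s -> _; rewrite rmorphXn.
move=> u; rewrite xH; split=> -[j ->].
  exists (l%:Z * j); apply/ffunP => i.
  by rewrite !ffunE {1}xE exprnP exprz_exp.
exists (k%:Z * j); apply/ffunP => i.
by rewrite !ffunE sE exprnP exprz_exp.
Qed.

End TorusAction.

(** * Finite and cyclic subgroups of the torus *)

Section Subgroups.

Variables (L : fieldType) (N : nat).
Implicit Types (z : {ffun 'I_N -> L}) (H : {fset {ffun 'I_N -> L}}).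

Lemma generates_mem z H : generates z H -> z \in H.
Proof.
by move=> zH; apply/zH; exists 1; apply/ffunP=> i; rewrite ffunE expr1z.
Qed.

Lemma finite_subgroup_torsion z H : finite_subgroup H -> z \in H ->
  torsion_point z.
Proof.
move=> [H0 H1 HM _] zH; pose n := size H.
have zX k : z ^+ k \in H by elim: k => [|k IH] //; rewrite exprS HM.
(* Pigeonhole: the [n.+1] powers of [z] up to exponent [n] cannot be distinct in a set of size
   [n]. *)
have : looping ( *%R z) 1 n.
  apply: contraT; rewrite -looping_uniq => z_uniq.
  have := uniq_leq_size (s2 := H) z_uniq.
  rewrite size_traject ltnn; apply => _ /trajectP[k _ ->].
  by rewrite iter_mulr_1.
case/trajectP => k k_n; rewrite !iter_mulr_1 => /ffunP zE.
exists (n - k)%N; first by rewrite subn_gt0.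
apply/ffunP => i; have := zE i.
rewrite !ffun_exprE -{1}(subnK (ltnW k_n)) exprD.
rewrite -[RHS]mul1r => /(mulIf (expf_neq0 _ (H0 z zH i))) ->.
by rewrite ffunE.
Qed.

Lemma finite_subgroup_exprz z H (k : int) : finite_subgroup H -> z \in H ->
  [ffun i => z i ^ k] \in H.
Proof.
move=> [_ H1 HM HV] zH.
have zX n : [ffun i => z i ^+ n] \in H.
  elim: n => [|n IH].
    by rewrite (_ : [ffun i => _] = 1) //; apply/ffunP => i; rewrite !ffunE.
  rewrite (_ : [ffun i => _] = z * [ffun i => z i ^+ n]) ?HM //.
  by apply/ffunP => i; rewrite !ffunE exprS.
case: k => n; first exact: zX.
rewrite (_ : [ffun i => _] = [ffun i => ([ffun i => z i ^+ n.+1] i)^-1]) ?HV //.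
by apply/ffunP => i; rewrite !ffunE.
Qed.

Lemma cyclic_subgroup_exists z H : finite_subgroup H -> z \in H ->
  exists C : {fset {ffun 'I_N -> L}},
    [/\ fsubset C H, generates z C & finite_cyclic_subgroup C].
Proof.
move=> H_grp zH.
pose C := [fset u in H |
  `[< exists k : int, u = [ffun i => z i ^ k] >]]%fset.
have zC : generates z C.
  move=> u; rewrite !inE; split=> [/andP[_ /asboolP //]|[k ->]].
  by rewrite finite_subgroup_exprz //=; apply/asboolP; exists k.
have CH : fsubset C H by apply/fsubsetP => u; rewrite !inE => /andP[].
have [H0 _ _ _] := H_grp.
exists C; split=> //; split; last by exists z.
split.
- by move=> u /(fsubsetP CH)/H0.
- by apply/zC; exists 0; apply/ffunP => i; rewrite !ffunE.
- move=> _ _ /zC[k ->] /zC[l ->]; apply/zC; exists (k + l); apply/ffunP => i.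
  by rewrite !ffunE expfzDr ?H0.
- move=> _ /zC[k ->]; apply/zC; exists (- k); apply/ffunP => i.
  by rewrite !ffunE invr_expz.
Qed.

Lemma generates_eq z H H' : generates z H -> generates z H' -> H = H'.
Proof.
move=> zH zH'; apply/fsetP => u; apply/idP/idP.
  by move/zH => ?; apply/zH'.
by move/zH' => ?; apply/zH.
Qed.

End Subgroups.

(** * Products over finite subgroups of the torus *)

Section Products.

Variables (R : idomainType) (L : fieldType) (N : nat).
Variable iota : {rmorphism {fraction R} -> L}.
Hypothesis closure : separable_closure iota.
Implicit Types (f : laurent R N) (H : {fset {ffun 'I_N -> L}}).

(** Generators are grouped by the representative of their orbit. Conjugation preserves both
    generating [H] and nonvanishing of [f], so each fibre is a whole orbit. *)
Lemma Vf_prod_Cf f H r (xi : 'I_r -> {ffun 'I_N -> L}) :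
    finite_cyclic_subgroup H -> orbit_representatives iota H xi ->
  Vf iota f H =
    \prod_(i < r | leval iota f (xi i) != 0)
      Cf iota f (xi i) ^+ Cexp iota f (xi i).
Proof.
move=> [H_grp [z0 z0H]] [xiH xi_inj xi_surj]; have [i0 _] := xi_surj _ z0H.
have xi_tors i : torsion_point (xi i).
  exact/(finite_subgroup_torsion H_grp)/generates_mem.
(* The index [i0], available because [H] has a generator, is the default value of [p] off the
   generators. *)
have /choice[p pP] z :
    exists i, generates z H -> conjugate_points iota (xi i) z.
  have [/xi_surj[i]|nz] := pselect (generates z H); first by exists i.
  by exists i0 => /nz.
rewrite /Vf (partition_big p (fun i => leval iota f (xi i) != 0)) /=;
  last first.
  by move=> z /andP[/asboolP/pP z_conj]; rewrite (conjugate_leval_eq0 f z_conj).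
apply: eq_bigr => i fi; have [O OE] := orbit_exists iota (xi_tors i).
rewrite -(Cf_prod_orbit closure f (xi_tors i) OE) -big_filter; apply: perm_big.
apply: uniq_perm; [by rewrite filter_uniq ?fset_uniq | exact: fset_uniq |].
move=> z; rewrite mem_filter OE; apply/idP/asboolP.
  by case/andP => /andP[/andP[/asboolP/pP + _] /eqP <-].
move=> z_conj.
have zH := conjugate_generates (xi_tors i) (xiH i) z_conj.
rewrite generates_mem // (conjugate_leval_eq0 f z_conj) fi !andbT.
apply/andP; split; first exact/asboolP.
by apply/eqP/xi_inj; apply: conjugate_points_joint (pP _ zH) z_conj.
Qed.

(** Each point of [H] generates exactly one cyclic subgroup of [H], so exchanging the two products
    leaves one factor per point. *)
Lemma Wf_prod_Vf f H : finite_subgroup H ->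
  Wf iota f H =
    \prod_(H' <- fpowerset H | `[< finite_cyclic_subgroup H' >]) Vf iota f H'.
Proof.
move=> H_grp; pose gen z H' := `[< generates z H' >] && (leval iota f z != 0).
(* Generators of [H'] lie in [H'], so the inner product may range over [H]; its index set then no
   longer depends on [H']. *)
have -> : \prod_(H' <- fpowerset H | `[< finite_cyclic_subgroup H' >])
      Vf iota f H' =
    \prod_(H' <- fpowerset H | `[< finite_cyclic_subgroup H' >])
      \prod_(z <- H | gen z H') leval iota f z.
  rewrite big_seq_cond [RHS]big_seq_cond; apply: eq_bigr => H'.
  rewrite fpowersetE => /andP[/fsubsetP H'H _].
  rewrite -[RHS]big_filter /Vf -big_filter; apply: perm_big.
  apply: uniq_perm; rewrite ?filter_uniq ?fset_uniq // => z.
  rewrite !mem_filter; apply: andb_id2l => /andP[/asboolP/generates_mem zH' _].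
  by rewrite zH' H'H.
rewrite (exchange_big_dep (fun z => leval iota f z != 0)) /=;
  last by move=> H' z _ /andP[].
rewrite /Wf big_seq_cond [RHS]big_seq_cond; apply: eq_bigr => z /andP[zH fz].
have [C [CH zC C_cyc]] := cyclic_subgroup_exists H_grp zH.
rewrite -big_filter (perm_big [:: C]) ?big_seq1 //; apply: uniq_perm => //.
  by rewrite filter_uniq ?fset_uniq.
move=> H'; rewrite mem_filter inE fpowersetE /gen fz andbT.
apply/idP/eqP => [/andP[/andP[_ /asboolP zH'] _]|->].
  exact: generates_eq zH' zC.
by rewrite CH andbT; apply/andP; split; apply/asboolP.
Qed.

End Products.

Theorem theorem4p3 (R : idomainType) (L : fieldType)
    (iota : {rmorphism {fraction R} -> L}) (N : nat) (f : laurent R N)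
    (R_closed : integrally_closed R) (L_closure : separable_closure iota)
    (N_gt0 : (0 < N)%N) (f_neq0 : f != 0) :
  (forall xi : {ffun 'I_N -> L}, torsion_point xi ->
     in_base iota (Cf iota f xi))
  /\
  (forall (H : {fset {ffun 'I_N -> L}}) (r : nat)
      (xi : 'I_r -> {ffun 'I_N -> L}),
     finite_cyclic_subgroup H -> orbit_representatives iota H xi ->
     in_base iota (Vf iota f H) /\
     Vf iota f H =
       \prod_(i < r | leval iota f (xi i) != 0)
         Cf iota f (xi i) ^+ Cexp iota f (xi i))
  /\
  (forall (H : {fset {ffun 'I_N -> L}})
      (r : {fset {ffun 'I_N -> L}} -> nat)
      (xi : forall H', 'I_(r H') -> {ffun 'I_N -> L}),
     finite_subgroup H ->
     (forall H' : {fset {ffun 'I_N -> L}}, fsubset H' H ->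
        finite_cyclic_subgroup H' -> orbit_representatives iota H' (@xi H')) ->
     in_base iota (Wf iota f H) /\
     Wf iota f H =
       \prod_(H' <- fpowerset H | `[< finite_cyclic_subgroup H' >])
         \prod_(i < r H' | leval iota f (xi H' i) != 0)
           Cf iota f (xi H' i) ^+ Cexp iota f (xi H' i)).
Proof.
have V_base H r (xi : 'I_r -> {ffun 'I_N -> L}) :
    finite_cyclic_subgroup H -> orbit_representatives iota H xi ->
  in_base iota (Vf iota f H).
  move=> H_cyc xiP; rewrite (Vf_prod_Cf L_closure f H_cyc xiP).
  have [[H_grp _] [xiH _ _]] := (H_cyc, xiP).
  apply: in_base_prod => i _; apply/in_baseX/Cf_in_base => //.
  exact/(finite_subgroup_torsion H_grp)/generates_mem.
split; first by move=> xi; apply: Cf_in_base.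
split=> [H r xi H_cyc xiP|H r xi H_grp xiP].
  by split; [apply: V_base xiP | apply: Vf_prod_Cf].
(* The membership condition is kept in the product because representatives are given only for
   subgroups of [H]. *)
rewrite Wf_prod_Vf // big_seq_cond [X in _ = X]big_seq_cond; split.
  apply: in_base_prod => H'; rewrite fpowersetE => /andP[H'H /asboolP H'_cyc].
  by apply: V_base (xiP H' H'H H'_cyc).
apply: eq_bigr => H'; rewrite fpowersetE => /andP[H'H /asboolP H'_cyc].
exact: Vf_prod_Cf (xiP H' H'H H'_cyc).
Qed.
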